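(* For every positive integer $d$, $f_{\mathrm{ae}}(d)\leq 5d^{13/9}$; that is, every almost-equidistant set in $\mathbb R^d$ has cardinality at most $5d^{13/9}$.
   Context: A finite set of points in $\mathbb R^d$ (with the Euclidean distance) is called almost-equidistant if among any three distinct points in the set, some two are at distance exactly $1$. The number $f_{\mathrm{ae}}(d)$ denotes the largest cardinality of an almost-equidistant set in $\mathbb R^d$. *)

(* Defs.v *)
From HB Require Import structures.
From mathcomp Require Import all_boot all_order all_algebra.
From mathcomp Require Import finmap.
From mathcomp Require Import reals exp.

Set Implicit Arguments.
Unset Strict Implicit.
Unset Printing Implicit Defensive.

Import Order.TTheory GRing.Theory Num.Theory.
Local Open Scope fset_scope.
Local Open Scope ring_scope.

(* The norm that MathComp-Analysis puts on 'rV[R]_d is the max norm, so the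
   Euclidean distance is defined explicitly. *)
Definition edist (R : realType) (d : nat) (x y : 'rV[R]_d) : R :=
  Num.sqrt (\sum_(i < d) (x 0 i - y 0 i) ^+ 2).

Definition almost_equidistant (R : realType) (d : nat)
    (A : {fset 'rV[R]_d}) : Prop :=
  forall x y z : 'rV[R]_d, x \in A -> y \in A -> z \in A ->
    x != y -> x != z -> y != z ->
    [\/ edist x y = 1, edist x z = 1 | edist y z = 1].

(* is_fae R d m says f_ae(d) = m; a relation, since the existence of a largest
   cardinality is itself a theorem. *)
Definition is_fae (R : realType) (d m : nat) : Prop :=
  (exists2 A : {fset 'rV[R]_d}, almost_equidistant A & #|` A| = m) /\
  (forall A : {fset 'rV[R]_d}, almost_equidistant A -> (#|` A| <= m)%N).

(* Main.v *)
Require Import Defs.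
From HB Require Import structures.
From mathcomp Require Import all_boot all_order all_algebra.
From mathcomp Require Import finmap.
From mathcomp Require Import boolp reals exp.
From mathcomp Require Import ring lra zify.

(** The proof gives the stronger bound n <= 5 d^(4/3), in the form
    n^3 <= 125 d^4, by comparing traces of powers of one symmetric matrix.

    For points x_1, ..., x_n let U be the matrix with entries
    |x_i - x_j|^2 - [i != j].  Its zero entries off the diagonal are the pairs
    at unit distance, so for an almost-equidistant set the graph of nonzero
    entries has no triangle.  Hence tr U = 0 and tr U^3 = 0
    ([trace_cube_excess]); moreover the neighbours of a vertex of this graph
    are pairwise at unit distance, so every row of U has at most d + 1 nonzero
    entries ([excess_degree]).

    Once the points are centred, U = I - M + 1c^T + c1^T, where M = 2XX^T is
    positive semidefinite of rank at most d and kills the all-ones vector 1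
    ([excess_decomp]).  Put T_k = tr M^k.  Cauchy-Schwarz gives
    T_1^2 <= d T_2 and T_2^2 <= T_1 T_3, and tr U = 0 makes T_1 about n.  The
    large negative eigenvalues that M produces contribute about -T_3 to
    tr U^3, and only the rank-two part can compensate this
    ([trace_cube_excess_le]).  Its size is measured by the mean square r of the
    row sums of U: its contribution is at most about sqrt 2 r^(3/2)
    ([rank2_cube_le]).  But the rows of U are sparse, so Cauchy-Schwarz bounds
    the row sums: n r <= (d + 1) tr U^2, which is about d T_2
    ([row_sums_le]).  So, up to constants,
    T_2^2 <= T_1 T_3 <= n (d T_2 / n)^(3/2), that is T_2 <= d^3 / n; as also
    T_2 >= n^2 / d, this forces n <= C d^(4/3).

    With the constants followed through, this gives n^3 <= 125 d^4 for d >= 20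
    ([moments_contradiction]).  For smaller d the Ramsey bound
    n <= (d + 1)(d + 4) / 2 for triangle-free graphs without d + 2 independent
    vertices is already sharp enough ([ramsey_bound]). *)

Set Implicit Arguments.
Unset Strict Implicit.
Unset Printing Implicit Defensive.

Import Order.TTheory GRing.Theory Num.Theory.
Local Open Scope fset_scope.
Local Open Scope ring_scope.

(** * Cauchy-Schwarz inequalities *)

(** Lagrange's identity: the defect is half the sum of the squares of the
    2 x 2 minors of the array with rows a and b. *)
Lemma cauchy_schwarz (R : realFieldType) (I : finType) (a b : I -> R) :
  (\sum_i a i * b i) ^+ 2 <= (\sum_i a i ^+ 2) * (\sum_i b i ^+ 2).
Proof.
have -> : (\sum_i a i * b i) ^+ 2 = \sum_i \sum_j (a i * b i) * (a j * b j).
  by rewrite expr2 mulr_suml; apply: eq_bigr => i _; rewrite mulr_sumr.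
have E : \sum_i \sum_j a i ^+ 2 * b j ^+ 2 =
    (\sum_i a i ^+ 2) * (\sum_i b i ^+ 2).
  by rewrite mulr_suml; apply: eq_bigr => i _; rewrite mulr_sumr.
have E' : \sum_i \sum_j a j ^+ 2 * b i ^+ 2 =
    (\sum_i a i ^+ 2) * (\sum_i b i ^+ 2).
  by rewrite exchange_big E.
have : 0 <= \sum_i \sum_j (a i * b j - a j * b i) ^+ 2.
  by apply: sumr_ge0 => i _; apply: sumr_ge0 => j _; exact: sqr_ge0.
have -> : \sum_i \sum_j (a i * b j - a j * b i) ^+ 2 =
   \sum_i \sum_j a i ^+ 2 * b j ^+ 2 + \sum_i \sum_j a j ^+ 2 * b i ^+ 2
   - (\sum_i \sum_j (a i * b i) * (a j * b j)) *+ 2.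
  rewrite -sumrMnl -!big_split -sumrB; apply: eq_bigr => i _.
  rewrite -sumrMnl -!big_split -sumrB; apply: eq_bigr => j _ /=; ring.
by rewrite E E'; lra.
Qed.

Lemma trace_cauchy_schwarz (R : realFieldType) m n (A B : 'M[R]_(m, n)) :
  (\tr (A^T *m B)) ^+ 2 <= \tr (A^T *m A) * \tr (B^T *m B).
Proof.
have E (C D : 'M[R]_(m, n)) :
    \tr (C^T *m D) = \sum_(p : 'I_n * 'I_m) C p.2 p.1 * D p.2 p.1.
  rewrite -(pair_big xpredT xpredT (fun i j => C j i * D j i)) /=.
  by apply: eq_bigr => i _; rewrite mxE; apply: eq_bigr => j _; rewrite mxE.
by rewrite !E; exact: cauchy_schwarz.
Qed.

Lemma trace_gram_ge0 (R : realFieldType) m n (A : 'M[R]_(m, n)) :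
  0 <= \tr (A^T *m A).
Proof.
apply: sumr_ge0 => i _; rewrite mxE; apply: sumr_ge0 => j _.
by rewrite mxE -expr2; exact: sqr_ge0.
Qed.

(** * Traces of a rank-two perturbation *)

Definition dot (R : realFieldType) n (x y : 'cV[R]_n) : R := \tr (x^T *m y).

Lemma dotC (R : realFieldType) n (x y : 'cV[R]_n) : dot x y = dot y x.
Proof. by rewrite /dot -mxtrace_tr trmx_mul trmxK. Qed.

Lemma dotDr (R : realFieldType) n (x y z : 'cV[R]_n) :
  dot x (y + z) = dot x y + dot x z.
Proof. by rewrite /dot mulmxDr linearD. Qed.

Lemma dotZr (R : realFieldType) n a (x y : 'cV[R]_n) :
  dot x (a *: y) = a * dot x y.
Proof. by rewrite /dot -scalemxAr linearZ. Qed.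

Lemma dotDl (R : realFieldType) n (x y z : 'cV[R]_n) :
  dot (y + z) x = dot y x + dot z x.
Proof. by rewrite dotC dotDr !(dotC x). Qed.

Lemma dotZl (R : realFieldType) n a (x y : 'cV[R]_n) :
  dot (a *: y) x = a * dot y x.
Proof. by rewrite dotC dotZr dotC. Qed.

Lemma dot_mul (R : realFieldType) m n (A : 'M[R]_(m,n)) x y :
  dot x (A *m y) = dot (A^T *m x) y.
Proof. by rewrite /dot trmx_mul trmxK mulmxA. Qed.
Lemma mul_outer (R : realFieldType) n (x y z : 'cV[R]_n) :
  x *m y^T *m z = dot y z *: x.
Proof.
by rewrite /dot trace_mx11 -mulmxA {1}[y^T *m z]mx11_scalar mul_mx_scalar.
Qed.

(** A symmetric A that fixes e is perturbed by the rank-two matrix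
    e c^T + c e^T.  The traces of the powers of the sum depend on e and c only
    through the scalars e.c, c.c and c.(A c). *)
Section RankTwo.
Variables (R : realFieldType) (n : nat) (A : 'M[R]_n) (e c : 'cV[R]_n).
Hypotheses (symA : A^T = A) (Ae : A *m e = e) (ee : dot e e = n%:R).
Let U := A + e *m c^T + c *m e^T.
Let g := dot e c.
Let p := dot c c.

(* The rank-two part is peeled off one factor at a time by this identity. *)
Let trM (M : 'M[R]_n) :
  \tr (U *m M) = \tr (A *m M) + dot c (M *m e) + dot e (M *m c).
Proof.
rewrite /U !mulmxDl !linearD /=.
by congr (_ + _ + _); rewrite -mulmxA mxtrace_mulC /dot mulmxA.
Qed.

Let Ue : U *m e = (1 + g) *: e + n%:R *: c.
Proof. by rewrite /U !mulmxDl !mul_outer Ae ee (dotC c) scalerDl scale1r. Qed.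

Let Uc : U *m c = A *m c + p *: e + g *: c.
Proof. by rewrite /U !mulmxDl !mul_outer. Qed.

Let symU : U^T = U.
Proof.
by rewrite /U !linearD /= !trmx_mul !trmxK symA -!addrA [_ + e *m _]addrC.
Qed.

Let eAc : dot e (A *m c) = g. Proof. by rewrite dot_mul symA Ae. Qed.

Lemma trace_rank2 : \tr U = \tr A + 2 * g.
Proof. by rewrite -[U]mulmx1 trM !mulmx1 !mul1mx (dotC c) -/g; ring. Qed.

Lemma trace_sqr_rank2 :
  \tr (U *m U) = \tr (A *m A) + 4 * g + 2 * (n%:R * p) + 2 * g ^+ 2.
Proof.
rewrite trM [\tr (A *m _)]mxtrace_mulC trM Ae eAc (dot_mul U e) symU Ue.
by rewrite dotDr dotDl !dotZl !dotZr (dotC c e) -/g -/p; ring.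
Qed.

Lemma trace_cube_rank2 :
  \tr (U *m U *m U) = \tr (A *m A *m A) + 6 * g + 2 * g ^+ 3 + 6 * g ^+ 2
    + 3 * (n%:R * p) + 6 * g * (n%:R * p) + 3 * (n%:R * dot c (A *m c)).
Proof.
have cycl (B : 'M[R]_n) : \tr (A *m (U *m B)) = \tr (U *m (B *m A)).
  by rewrite mxtrace_mulC mulmxA.
rewrite -mulmxA trM cycl trM cycl trM.
have symdot x y : dot x (U *m y) = dot (U *m x) y by rewrite dot_mul symU.
rewrite -!mulmxA !Ae (symdot c (U *m e)) (symdot e (U *m c)) (symdot e).
rewrite Ue Uc !(dotDr, dotDl, dotZl, dotZr) (dot_mul A e) symA Ae eAc ee.
by rewrite (dotC c e) (dotC (A *m c) e) eAc (dotC (A *m c)) -/g -/p; ring.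
Qed.

End RankTwo.

(** * The excess matrix and the moments of the Gram matrix *)

Definition sqdist (R : realFieldType) n d (X : 'M[R]_(n, d)) (i j : 'I_n) : R :=
  \sum_k (X i k - X j k) ^+ 2.

Definition excess (R : realFieldType) n d (X : 'M[R]_(n, d)) : 'M[R]_n :=
  \matrix_(i, j) (sqdist X i j - (i != j)%:R).

Definition ones (R : realFieldType) n : 'cV[R]_n := const_mx 1.

(** Shifting the squared norms by 1/2 absorbs the constant -1 of the
    off-diagonal entries of the excess matrix into the rank-two part. *)
Definition sqnorms (R : realFieldType) n d (X : 'M[R]_(n, d)) : 'cV[R]_n :=
  \col_i (\sum_k X i k ^+ 2 - 2^-1).

Definition gram2 (R : realFieldType) n d (X : 'M[R]_(n, d)) : 'M[R]_n :=
  2 *: (X *m X^T).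

(** Expansion of |x_i - x_j|^2 into norms and inner products.  The entries
    [i != j] are those of the all-ones matrix minus the identity. *)
Lemma excess_decomp (R : realFieldType) n d (X : 'M[R]_(n, d)) :
  excess X = (1%:M - gram2 X) + ones R n *m (sqnorms X)^T
             + sqnorms X *m (ones R n)^T.
Proof.
apply/matrixP => i j; rewrite !mxE !big_ord1 !mxE mul1r mulr1.
have -> : sqdist X i j = \sum_k X i k ^+ 2 + \sum_k X j k ^+ 2
     - 2 * \sum_k X i k * X^T k j.
  rewrite /sqdist mulr_sumr -big_split -sumrB; apply: eq_bigr => k _ /=.
  by rewrite mxE; ring.
by case: eqP => _ /=; field.
Qed.

Section Moments.
Variables (R : realFieldType) (n d : nat) (X : 'M[R]_(n, d)).
Let M := gram2 X.
Let T1 := \tr M.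
Let T2 := \tr (M *m M).
Let T3 := \tr (M *m M *m M).

Lemma gram2_sym : M^T = M.
Proof. by rewrite /M /gram2 linearZ /= trmx_mul trmxK. Qed.

Lemma dot_gram2_ge0 x : 0 <= dot x (M *m x).
Proof.
rewrite /M /gram2 -scalemxAl dotZr -mulmxA dot_mul mulr_ge0 //.
exact: trace_gram_ge0.
Qed.

Let T1E : \tr (X^T *m X) = T1 / 2.
Proof.
by rewrite /T1 /M /gram2 linearZ /= [\tr (X *m _)]mxtrace_mulC; field.
Qed.
Let T2E : \tr ((M *m X)^T *m X) = T2 / 2.
Proof.
rewrite trmx_mul gram2_sym mxtrace_mulC mulmxA mxtrace_mulC.
by rewrite /T2 {3}/M /gram2 -scalemxAr linearZ /=; field.
Qed.
Let T3E : \tr ((M *m X)^T *m (M *m X)) = T3 / 2.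
Proof.
rewrite trmx_mul gram2_sym mxtrace_mulC !mulmxA mxtrace_mulC.
by rewrite /T3 {5}/M /gram2 -scalemxAr linearZ /= !mulmxA; field.
Qed.

Lemma moment1_ge0 : 0 <= T1.
Proof. by have := trace_gram_ge0 X; rewrite T1E; lra. Qed.

(** M and the d x d matrix 2 X^T X have the same moments, so the factor is the
    trace of the d x d identity matrix: here the dimension enters. *)
Lemma moment_ineq12 : T1 ^+ 2 <= d%:R * T2.
Proof.
have := trace_cauchy_schwarz 1%:M (X^T *m X).
rewrite trmx1 !mul1mx mxtrace1 trmx_mul trmxK T1E.
have -> : \tr (X^T *m X *m (X^T *m X)) = T2 / 4.
  rewrite -mulmxA mxtrace_mulC -mulmxA.
  rewrite /T2 /M /gram2 -scalemxAr -scalemxAl !linearZ /= -!mulmxA.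
  by field.
lra.
Qed.

(** Cauchy-Schwarz for X and M X, whose trace products are T1 / 2, T2 / 2
    and T3 / 2. *)
Lemma moment_ineq23 : T2 ^+ 2 <= T1 * T3.
Proof.
have := trace_cauchy_schwarz (M *m X) X.
by rewrite T1E T2E T3E; lra.
Qed.

End Moments.

Lemma sqdistC (R : realFieldType) n d (X : 'M[R]_(n, d)) i j :
  sqdist X i j = sqdist X j i.
Proof. by apply: eq_bigr => k _; rewrite -sqrrN opprB. Qed.

Lemma excessC (R : realFieldType) n d (X : 'M[R]_(n, d)) i j :
  excess X i j = excess X j i.
Proof. by rewrite !mxE sqdistC eq_sym. Qed.

Lemma excess_diag (R : realFieldType) n d (X : 'M[R]_(n, d)) i :
  excess X i i = 0.
Proof.
by rewrite mxE eqxx subr0 /sqdist big1 // => k _; rewrite subrr expr0n.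
Qed.

Lemma excess_eq0 (R : realFieldType) n d (X : 'M[R]_(n, d)) i j : i != j ->
  (excess X i j == 0) = (sqdist X i j == 1).
Proof. by move=> ij; rewrite mxE ij subr_eq0. Qed.

(** * Trace identities for centred points *)

Definition row_sums (R : realFieldType) n d (X : 'M[R]_(n, d)) : 'cV[R]_n :=
  excess X *m ones R n.

Definition mean_row_sum (R : realFieldType) n d (X : 'M[R]_(n, d)) : R :=
  dot (ones R n) (row_sums X) / n%:R.

Definition var_row_sum (R : realFieldType) n d (X : 'M[R]_(n, d)) : R :=
  dot (row_sums X) (row_sums X) / n%:R - mean_row_sum X ^+ 2.

Lemma dot_ones (R : realFieldType) n : dot (ones R n) (ones R n) = n%:R.
Proof.
rewrite /dot trace_mx11 mxE -[n in RHS]card_ord -sumr_const.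
by apply: eq_bigr => i _; rewrite !mxE mulr1.
Qed.

Lemma centering (R : realFieldType) n d (X : 'M[R]_(n, d)) : (0 < n)%N ->
  exists2 Y : 'M[R]_(n, d), Y^T *m ones R n = 0 & excess Y = excess X.
Proof.
move=> n_gt0; have n0 : n%:R != 0 :> R by rewrite pnatr_eq0 -lt0n.
exists (\matrix_(i, k) (X i k - (\sum_j X j k) / n%:R)).
  apply/matrixP => k z; rewrite !mxE.
  under eq_bigr => j _ do rewrite !mxE mulr1.
  by rewrite sumrB sumr_const card_ord -[_ / _ *+ n]mulr_natr divfK // subrr.
apply/matrixP => i j; rewrite !mxE; congr (_ - _); apply: eq_bigr => k _.
by rewrite !mxE; congr (_ ^+ 2); ring.
Qed.

(** For centred points the all-ones vector is killed by M, so [RankTwo] applies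
    to A = I - M.  The two unknown scalars e.c and n (c.c) are traded for the
    mean s and the variance q of the row sums of U, which have an invariant
    meaning: if P is the projection along e onto its orthogonal complement, then
    U - (P - M) acts on the plane of e and c, and its matrix there, in an
    orthonormal basis starting with e / sqrt n, has entries s, sqrt q, sqrt q
    and 0. *)
Section Centered.
Variables (R : realFieldType) (n d : nat) (X : 'M[R]_(n, d)).
Hypotheses (n_gt0 : (0 < n)%N) (centered : X^T *m ones R n = 0).
Let U := excess X.
Let M := gram2 X.
Let T1 := \tr M.
Let T2 := \tr (M *m M).
Let T3 := \tr (M *m M *m M).
Let e := ones R n.
Let c := sqnorms X.
Let g := dot e c.
Let Q := n%:R * dot c c.
Let s := mean_row_sum X.
Let q := var_row_sum X.
Let A := 1%:M - M.

Let n0 : n%:R != 0 :> R. Proof. by rewrite pnatr_eq0 -lt0n. Qed.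

Let Me : M *m e = 0.
Proof. by rewrite /M /gram2 -scalemxAl -mulmxA centered mulmx0 scaler0. Qed.

Let symA : A^T = A.
Proof. by rewrite /A linearB /= trmx1 gram2_sym. Qed.

Let Ae : A *m e = e.
Proof. by rewrite /A mulmxBl Me mul1mx subr0. Qed.

Let row_sumsE : row_sums X = (1 + g) *: e + n%:R *: c.
Proof.
rewrite /row_sums excess_decomp -/M -/A -/e 2!mulmxDl !mul_outer Ae dot_ones.
by rewrite (dotC (sqnorms X)) scalerDl scale1r.
Qed.

Let gE : g = (s - 1) / 2.
Proof.
rewrite /s /mean_row_sum row_sumsE dotDr !dotZr dot_ones -/e -/g.
by field.
Qed.

Let QE : Q = q + g ^+ 2.
Proof.
rewrite /q /var_row_sum -/s row_sumsE !(dotDr, dotDl, dotZl, dotZr) dot_ones.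
rewrite (dotC c) -/e -/g.
have -> : s = 2 * g + 1 by rewrite gE; field.
by rewrite /Q; field.
Qed.

Let trA : \tr A = n%:R - T1.
Proof. by rewrite /A linearB /= mxtrace1. Qed.

Let trA2 : \tr (A *m A) = n%:R - 2 * T1 + T2.
Proof.
rewrite /A mulmxBl !mulmxBr !(mul1mx, mulmx1) !linearB /= mxtrace1.
by rewrite -/T1 -/T2; ring.
Qed.

Let trA3 : \tr (A *m A *m A) = n%:R - 3 * T1 + 3 * T2 - T3.
Proof.
rewrite /A !(mulmxBl, mulmxBr, mul1mx, mulmx1) !linearB /= mxtrace1.
by rewrite -/T1 -/T2 -/T3; ring.
Qed.

Lemma var_row_sum_ge0 : 0 <= q.
Proof.
have -> : q = Q - g ^+ 2 by rewrite QE; ring.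
rewrite subr_ge0 /g /dot (le_trans (trace_cauchy_schwarz _ _)) //.
by rewrite -/(dot _ _) dot_ones.
Qed.

Lemma moment1_mean_row_sum : T1 = n%:R - 1 + s.
Proof.
have : \tr U = 0 by apply: big1 => i _; exact: excess_diag.
rewrite /U excess_decomp trace_rank2 trA -/e -/c -/g gE.
by move=> h; lra.
Qed.

Lemma trace_sqr_excess :
  \tr (U *m U) = n%:R - 1 - 2 * T1 + T2 + s ^+ 2 + 2 * q.
Proof.
rewrite /U excess_decomp (trace_sqr_rank2 _ symA Ae (dot_ones R n)) trA2.
by rewrite -/e -/c -/g -/Q QE gE; field.
Qed.

(** The one term of tr U^3 that the moments do not determine is
    3n (c.(Ac)) = 3n (c.c - c.(Mc)), and it is bounded above because M is
    positive semidefinite. *)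
Lemma trace_cube_excess_le :
  \tr (U *m U *m U) <= n%:R - 1 - 3 * T1 + 3 * T2 - T3
                       + s ^+ 3 + 3 * s * q + 3 * q.
Proof.
rewrite /U excess_decomp (trace_cube_rank2 _ symA Ae (dot_ones R n)) trA3.
rewrite -/e -/c -/g -/Q.
have : n%:R * dot c (A *m c) <= Q.
  apply: ler_wpM2l; first exact: ler0n.
  rewrite /A mulmxBl mul1mx dotDr -scaleN1r dotZr.
  by have := dot_gram2_ge0 X c; rewrite -/M; lra.
have -> : s = 2 * g + 1 by rewrite gE; field.
have -> : q = Q - g ^+ 2 by rewrite QE; ring.
by lra.
Qed.

End Centered.

(** * Unit simplices and sparsity of the excess matrix *)

Lemma trace_sqrE (R : realFieldType) n d (X : 'M[R]_(n, d)) :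
  \tr (excess X *m excess X) = \sum_i \sum_j excess X i j ^+ 2.
Proof.
apply: eq_bigr => i _; rewrite mxE; apply: eq_bigr => j _.
by rewrite (excessC X j) expr2.
Qed.

(** The excess matrix of a unit simplex vanishes, so after centring the trace
    identities read T1 = T2 = n - 1, and T1^2 <= d T2 becomes n - 1 <= d. *)
Lemma unit_simplex (R : realFieldType) n d (X : 'M[R]_(n, d)) :
  (forall i j, i != j -> sqdist X i j = 1) -> (n <= d.+1)%N.
Proof.
move=> X1; case: n X X1 => // n X X1.
have [Y Yc YX] := centering X (ltn0Sn n).
have Y0 : excess Y = 0.
  rewrite YX; apply/matrixP => i j; rewrite [RHS]mxE.
  have [-> | ij] := eqVneq i j; first exact: excess_diag.
  by apply/eqP; rewrite excess_eq0 // X1.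
have s0 : row_sums Y = 0 by rewrite /row_sums Y0 mul0mx.
have m0 : mean_row_sum Y = 0.
  by rewrite /mean_row_sum s0 /dot mulmx0 linear0 mul0r.
have v0 : var_row_sum Y = 0.
  by rewrite /var_row_sum m0 s0 /dot mulmx0 linear0 mul0r expr0n subr0.
have := trace_sqr_excess (ltn0Sn n) Yc.
have := moment1_mean_row_sum (ltn0Sn n) Yc.
have := moment_ineq12 Y.
rewrite Y0 mul0mx linear0 m0 v0 => h12 h1 h2.
have {h12} : n%:R ^+ 2 <= d%:R * n%:R :> R.
  have nE : n.+1%:R = n%:R + 1 :> R by rewrite -addn1 natrD.
  by move: h12; rewrite nE in h1 h2; rewrite h1; nra.
rewrite -natrX -natrM ler_nat expnS expn1 ltnS.
by case: n {X X1 Y Yc YX Y0 s0 m0 v0 h1 h2} => // n; rewrite leq_pmul2r.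
Qed.

Lemma unit_clique (R : realFieldType) n d (X : 'M[R]_(n, d)) (S : {set 'I_n}) :
  {in S &, forall i j, i != j -> sqdist X i j = 1} -> (#|S| <= d.+1)%N.
Proof.
move=> S1; apply: (@unit_simplex R _ _ (rowsub (@enum_val _ (mem S)) X)).
move=> i j ij; rewrite -[RHS](S1 (enum_val i) (enum_val j)) ?enum_valP //.
  by apply: eq_bigr => k _; rewrite !mxE.
by apply: contra ij => /eqP /enum_val_inj ->.
Qed.

Section AlmostEquidistant.
Variables (R : realFieldType) (n d : nat) (X : 'M[R]_(n, d)).
Hypothesis ae : forall i j k, i != j -> i != k -> j != k ->
  [|| sqdist X i j == 1, sqdist X i k == 1 | sqdist X j k == 1].
Let U := excess X.

(** If two indices coincide, a diagonal entry, which is 0, occurs in the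
    product. *)
Lemma excess_triangle i j k : U i j * U j k * U k i = 0.
Proof.
have [-> | ij] := eqVneq i j; first by rewrite /U excess_diag !mul0r.
have [-> | ik] := eqVneq i k; first by rewrite /U excess_diag !mulr0.
have [-> | jk] := eqVneq j k; first by rewrite /U excess_diag mulr0 mul0r.
rewrite /U (excessC X k).
by case/or3P: (ae ij ik jk); rewrite -excess_eq0 // => /eqP ->;
  rewrite !(mulr0, mul0r).
Qed.

Lemma trace_cube_excess : \tr (U *m U *m U) = 0.
Proof.
apply: big1 => i _; rewrite mxE; apply: big1 => k _; rewrite mxE mulr_suml.
by apply: big1 => j _; exact: excess_triangle.
Qed.

(** Two neighbours of i that were adjacent would close a triangle; hence the
    neighbours of i form a unit simplex. *)
Lemma excess_degree i : (#|[set j | U i j != 0%R]| <= d.+1)%N.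
Proof.
apply: (@unit_clique R n d X) => j k; rewrite !inE => Uij Uik jk; apply/eqP.
rewrite -excess_eq0 //; have := excess_triangle i j k.
move/eqP; rewrite !mulf_eq0 (negPf Uij) /U (excessC X k) (negPf Uik) orbF.
by [].
Qed.

Lemma row_sums_le :
  dot (row_sums X) (row_sums X) <= d.+1%:R * \tr (U *m U).
Proof.
rewrite trace_sqrE /dot trace_mx11 mxE mulr_sumr; apply: ler_sum => i _.
rewrite mxE -expr2 /row_sums mxE.
under eq_bigr => j _ do rewrite [ones _ _ _ _]mxE mulr1.
(* The indicator of the support costs the degree d + 1 instead of n. *)
have -> : \sum_j excess X i j = \sum_j (U i j != 0)%:R * U i j.
  by apply: eq_bigr => j _; case: eqP => [|_]; rewrite ?mul1r // mul0r.
apply: le_trans (cauchy_schwarz _ _) _.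
apply: ler_wpM2r; first by apply: sumr_ge0 => j _; exact: sqr_ge0.
under eq_bigr => j _ do rewrite -natrX.
rewrite -natr_sum ler_nat; apply: leq_trans (excess_degree i).
rewrite cardsE -sum1_card [leqRHS]big_mkcond /=.
by apply: leq_sum => j _; rewrite unfold_in /=; case: eqP.
Qed.

End AlmostEquidistant.

(** * Incompatibility of the moments with many points *)

(** The left-hand side is the square of tr B^3 for the symmetric 2 x 2 matrix B
    with entries s, sqrt q, sqrt q, 0, and q + s^2 is the squared norm of its
    first column.  The bound is attained at q = s^2. *)
Lemma rank2_cube_le (R : realFieldType) (s q : R) : 0 <= q ->
  (s ^+ 3 + 3 * s * q) ^+ 2 <= 2 * (q + s ^+ 2) ^+ 3.
Proof.
move=> q0; rewrite -subr_ge0.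
have -> : 2 * (q + s ^+ 2) ^+ 3 - (s ^+ 3 + 3 * s * q) ^+ 2 =
  (s ^+ 2 - q) ^+ 2 * (s ^+ 2 + 2 * q) by ring.
have := sqr_ge0 s => s0.
by apply: mulr_ge0; [exact: sqr_ge0 | lra].
Qed.

(** D and N are the dimension and the number of points, s and q the mean and the
    variance of the row sums, and W the squared Frobenius norm of U.  The
    hypothesis N^3 > 125 D^4 makes the rank-two contribution T1 w to T1 T3 at
    most T2^2 / 5.  What is left of T2^2 <= T1 T3 then gives T2 <= 5 T1, hence
    T1 <= 5 D and a small s, whereas T1 = N - 1 + s and N >= 13 D.  Until
    the last step T1 is controlled through T1^2 <= D T2, because T1 = N - 1 + s
    is useful only once s is known to be small. *)
Lemma moments_contradiction (R : realFieldType) (D N T1 T2 T3 s q W : R) :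
  20 <= D -> 125 * D ^+ 4 < N ^+ 3 -> 0 <= N ->
  0 <= T1 -> T1 ^+ 2 <= D * T2 -> T2 ^+ 2 <= T1 * T3 ->
  0 <= q -> T1 = N - 1 + s ->
  W = N - 1 - 2 * T1 + T2 + s ^+ 2 + 2 * q ->
  T3 <= N - 1 - 3 * T1 + 3 * T2 + s ^+ 3 + 3 * s * q + 3 * q ->
  N * (q + s ^+ 2) <= (D + 1) * W -> False.
Proof.
move=> D20 ND N0 T10 h12 h23 q0 T1E WE T3le rowle.
have D0 : 0 < D by lra.
(* N^3 > 125 * 20 D^3 = 2500 D^3, and 13^3 = 2197. *)
have ND13 : 13 * D <= N.
  rewrite leNgt; apply/negP => lt; move: ND; apply/negP; rewrite -leNgt.
  have : N ^+ 3 <= (13 * D) ^+ 3 by apply: lerXn2r; rewrite ?nnegrE; lra.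
  have : 20 * D ^+ 3 <= D * D ^+ 3.
    by apply: ler_wpM2r => //; apply: exprn_ge0; lra.
  have : 0 <= D ^+ 3 by apply: exprn_ge0; lra.
  rewrite exprMn -[D * D ^+ 3]exprS; lra.
set r := q + s ^+ 2 in rowle.
have s0 := sqr_ge0 s.
have r0 : 0 <= r by rewrite /r; lra.
have T20 : 0 <= T2.
  by rewrite -(pmulr_rge0 _ D0); apply: le_trans h12; exact: sqr_ge0.
(* The constant absorbs the terms 2 r on the right, since 21/10 D r is at most
   (21/130) N r, and (21/20) / (1 - 21/130) < 13/10. *)
have Nr : N * r <= 13 / 10 * (D * T2).
  have Wle : W <= T2 + 2 * r.
    by have := sqr_ge0 (s + 1); rewrite WE T1E /r => ?; nra.
  have h1 : (D + 1) * W <= 21 / 20 * D * (T2 + 2 * r).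
    apply: (@le_trans _ _ ((D + 1) * (T2 + 2 * r))).
      by apply: ler_wpM2l => //; lra.
    by apply: ler_wpM2r; lra.
  have : 13 * D * r <= N * r by apply: ler_wpM2r.
  have : 0 <= D * T2 by apply: mulr_ge0 => //; lra.
  by move=> h2 h3; move: h1 rowle h2 h3; lra.
have rT2 : r <= T2 / 10.
  rewrite -(ler_pM2l D0).
  have : 13 * D * r <= N * r by apply: ler_wpM2r.
  by move: Nr; lra.
set w := s ^+ 3 + 3 * s * q.
have T3le' : T3 <= 33 / 10 * T2 + w by move: T3le rT2; rewrite T1E /w /r; nra.
(* Comparing squares: the coefficient 2 (13/10)^3 / 125 is below 1/25. *)
have T1w : T1 * w <= T2 ^+ 2 / 5.
  have T22 : 0 <= T2 ^+ 2 by exact: sqr_ge0.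
  apply: le_trans (ler_norm _) _.
  rewrite -[_ / 5]ger0_norm; last by lra.
  rewrite -ler_sqr ?nnegrE // !real_normK ?num_real //.
  have N3 : 0 < N ^+ 3 by apply: exprn_gt0; lra.
  rewrite -(ler_pM2l N3).
  have w2 : w ^+ 2 <= 2 * r ^+ 3 by exact: rank2_cube_le.
  have Nr3 : (N * r) ^+ 3 <= (13 / 10 * (D * T2)) ^+ 3.
    by apply: lerXn2r; rewrite ?nnegrE //; apply: mulr_ge0 => //; try lra;
       apply: mulr_ge0; lra.
  have e1 : (T1 * w) ^+ 2 <= D * T2 * (2 * r ^+ 3).
    rewrite exprMn; apply: ler_pM => //; exact: sqr_ge0.
  have e2 : N ^+ 3 * (T1 * w) ^+ 2 <= N ^+ 3 * (D * T2 * (2 * r ^+ 3)).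
    by apply: ler_wpM2l => //; lra.
  apply: (le_trans e2).
  have -> : N ^+ 3 * (D * T2 * (2 * r ^+ 3)) = 2 * (D * T2) * (N * r) ^+ 3.
    by ring.
  have DT0 : 0 <= 2 * (D * T2) by do 2!(apply: mulr_ge0 => //; try lra).
  apply: (le_trans (ler_wpM2l DT0 Nr3)).
  have T24 : 0 <= T2 ^+ 4 by exact: exprn_ge0.
  have : 125 * D ^+ 4 * T2 ^+ 4 <= N ^+ 3 * T2 ^+ 4.
    by apply: ler_wpM2r => //; lra.
  have : 0 <= D ^+ 4 * T2 ^+ 4 by apply: mulr_ge0 => //; apply: exprn_ge0; lra.
  lra.
have T2T1 : T2 <= 5 * T1.
  have h : T2 * T2 <= 33 / 8 * (T1 * T2).
    have : T1 * T3 <= T1 * (33 / 10 * T2 + w) by apply: ler_wpM2l.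
    by move: h23 T1w; lra.
  have [T2p|] := ltP 0 T2; last by lra.
  by rewrite -(ler_pM2r T2p); nra.
have T1D : T1 <= 5 * D.
  have [T1p|] := ltP 0 T1; last by lra.
  by rewrite -(ler_pM2r T1p); nra.
have : s ^+ 2 <= (3 / 2 * D) ^+ 2.
  have : s ^+ 2 <= r by rewrite /r; lra.
  nra.
have D32 : 0 <= 3 / 2 * D by lra.
rewrite -[s ^+ 2]real_normK ?num_real // ler_sqr ?nnegrE // ler_norml.
move=> /andP[h _].
by move: h T1D T1E; lra.
Qed.

(** * Ramsey bound for triangle-free graphs *)

Definition independent (T : finType) (adj : rel T) (S : {set T}) :=
  {in S &, forall x y, ~~ adj x y}.

(** Induction on the independence number: delete a vertex v and its at most a
    neighbours, which are independent.  Independent sets of the remaining graph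
    can be enlarged by v, so their size is at most a - 1. *)
Lemma triangle_free_card (T : finType) (adj : rel T) (a : nat) (V : {set T}) :
  symmetric adj -> irreflexive adj ->
  (forall x y z, adj x y -> adj x z -> ~~ adj y z) ->
  (forall S : {set T}, S \subset V -> independent adj S -> (#|S| <= a)%N) ->
  (2 * #|V| <= a * (a + 3))%N.
Proof.
move=> sym irr tf; elim: a V => [|a IH] V ind.
  suff -> : V = set0 by rewrite cards0.
  apply/setP => v; rewrite inE; apply/negP => vV.
  have := ind [set v]; rewrite sub1set vV cards1 => /(_ isT).
  suff iv : independent adj [set v] by move=> /(_ iv).
  by move=> x y /set1P -> /set1P ->; rewrite irr.
have [-> | /set0Pn[v vV]] := eqVneq V set0; first by rewrite cards0 muln0.
pose N := [set x in V | adj v x]; pose V' := V :\: (v |: N).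
have cN : (#|N| <= a.+1)%N.
  apply: ind; first by apply/subsetP => x /setIdP[].
  by move=> x y /setIdP[_ vx] /setIdP[_ vy]; exact: tf vx vy.
have cV' : (2 * #|V'| <= a * (a + 3))%N.
  apply: IH => S SV' iS; rewrite -ltnS.
  have nS x : x \in S -> (x != v) && ~~ adj v x.
    move/(subsetP SV'); rewrite !inE negb_or => /andP[/andP[-> /=]].
    by move=> + xV; rewrite xV.
  have -> : #|S|.+1 = #|v |: S|.
    rewrite cardsU1; case: (boolP (v \in S)) => // /nS.
    by rewrite eqxx.
  apply: ind.
    rewrite subUset sub1set vV; apply: subset_trans SV' _.
    exact: subsetDl.
  move=> x y /setU1P[-> | xS] /setU1P[-> | yS]; rewrite ?irr //.
  - by case/andP: (nS _ yS).
  - by rewrite sym; case/andP: (nS _ xS).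
  - exact: iS.
have : (#|V| <= #|V'| + #|N|.+1)%N.
  rewrite -(cardsID (v |: N) V) addnC leq_add2l.
  apply: leq_trans (subset_leq_card (subsetIr _ _)) _.
  by rewrite cardsU1 -[#|N|.+1]add1n leq_add2r; case: (_ \in _).
by nia.
Qed.

(** * The bound on almost-equidistant sets *)

Lemma small_dimension d : (0 < d)%N -> (d < 20)%N ->
  (((d + 1) * (d + 4)) ^ 3 <= 1000 * d ^ 4)%N.
Proof. by move: d; do 20 (case; first by lia); lia. Qed.

Section Bound.
Variables (R : realFieldType) (n d : nat) (X : 'M[R]_(n, d)).
Hypothesis ae : forall i j k, i != j -> i != k -> j != k ->
  [|| sqdist X i j == 1, sqdist X i k == 1 | sqdist X j k == 1].

Lemma ramsey_bound : (2 * n <= (d + 1) * (d + 4))%N.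
Proof.
rewrite (addnA d 1%N 3%N) addn1 -[n in (2 * n)%N]card_ord -cardsT.
apply: (@triangle_free_card _ (fun i j => excess X i j != 0)).
- by move=> i j; rewrite excessC.
- by move=> i; rewrite excess_diag eqxx.
- move=> i j k ij ik; apply/negPn/eqP; move/eqP: (excess_triangle ae i j k).
  by rewrite !mulf_eq0 (negPf ij) (excessC X k) (negPf ik) orbF => /eqP.
move=> S _ iS; apply: (@unit_clique R n d X) => i j iS' jS' ij.
by apply/eqP; rewrite -excess_eq0 //; apply/negPn/iS.
Qed.

(** Centring does not change the excess matrix, so the sparsity and the triangle
    condition pass to the centred points. *)
Lemma spectral_bound : (20 <= d)%N -> (n ^ 3 <= 125 * d ^ 4)%N.
Proof.
move=> d20; rewrite leqNgt; apply/negP => big.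
have n_gt0 : (0 < n)%N by case: (n) big => //; rewrite exp0n.
have [Y Yc YX] := centering X n_gt0.
have aeU i j k : i != j -> i != k -> j != k ->
    [|| sqdist Y i j == 1, sqdist Y i k == 1 | sqdist Y j k == 1].
  by move=> ij ik jk; rewrite -!excess_eq0 // YX !excess_eq0 //; exact: ae.
have T3le := trace_cube_excess_le n_gt0 Yc.
rewrite (trace_cube_excess aeU) in T3le.
have rowle := row_sums_le aeU.
have n0 : n%:R != 0 :> R by rewrite pnatr_eq0 -lt0n.
have rowE : dot (row_sums Y) (row_sums Y) =
    n%:R * (var_row_sum Y + mean_row_sum Y ^+ 2).
  by rewrite /var_row_sum subrK mulrC divfK.
rewrite rowE -[d.+1]addn1 natrD in rowle.
apply: (@moments_contradiction R d%:R n%:R _ _ _ _ _ _ _ _ _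
  (moment1_ge0 Y) (moment_ineq12 Y) (moment_ineq23 Y)
  (var_row_sum_ge0 n_gt0 Yc) (moment1_mean_row_sum n_gt0 Yc)
  (trace_sqr_excess n_gt0 Yc) _ rowle).
- by rewrite ler_nat.
- by rewrite -!natrX -natrM ltr_nat.
- exact: ler0n.
- by move: T3le; lra.
Qed.

Lemma four_thirds_bound : (0 < d)%N -> (n ^ 3 <= 125 * d ^ 4)%N.
Proof.
move=> d_gt0; have [/spectral_bound // | d20] := leqP 20 d.
have h := ramsey_bound.
have : ((2 * n) ^ 3 <= ((d + 1) * (d + 4)) ^ 3)%N by rewrite leq_exp2r.
have := small_dimension d_gt0 d20.
rewrite expnMn; lia.
Qed.

End Bound.

Lemma edist_eq1 (R : realType) n d (X : 'M[R]_(n, d)) i j :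
  edist (row i X) (row j X) = 1 -> sqdist X i j == 1.
Proof.
have -> : edist (row i X) (row j X) = Num.sqrt (sqdist X i j).
  by congr Num.sqrt; apply: eq_bigr => k _; rewrite !mxE.
have X0 : 0 <= sqdist X i j by apply: sumr_ge0 => k _; exact: sqr_ge0.
by move=> h; rewrite -(sqr_sqrtr X0) h expr1n.
Qed.

Lemma almost_equidistant_card (R : realType) d (A : {fset 'rV[R]_d}) :
  (0 < d)%N -> almost_equidistant A -> (#|` A| ^ 3 <= 125 * d ^ 4)%N.
Proof.
move=> d_gt0 aeA; rewrite cardfE.
pose X : 'M[R]_(#|{: A}|, d) := \matrix_i val (enum_val i : A).
have rowX i : row i X = val (enum_val i : A) by rewrite rowK.
apply: (@four_thirds_bound R _ d X) => // i j k ij ik jk.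
have neq i' j' : i' != j' -> row i' X != row j' X.
  by apply: contra; rewrite !rowX => /eqP /val_inj /enum_val_inj ->.
have inA i' : row i' X \in A by rewrite rowX; exact: valP.
apply/or3P.
by case: (aeA _ _ _ (inA i) (inA j) (inA k)
              (neq _ _ ij) (neq _ _ ik) (neq _ _ jk))
  => /edist_eq1 h; [constructor 1 | constructor 2 | constructor 3].
Qed.

Lemma le_thirteen_ninths_power (R : realType) (n d : nat) : (0 < d)%N ->
  (n ^ 3 <= 125 * d ^ 4)%N -> n%:R <= 5 * d%:R `^ (13 / 9) :> R.
Proof.
move=> d_gt0 h.
have d1 : 1 <= d%:R :> R by rewrite ler1n.
apply: (@le_trans _ _ (5 * d%:R `^ (4 / 3))); last first.
  by apply: ler_wpM2l => //; apply: ler_powR => //; lra.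
rewrite -(@ler_pXn2r _ 3%N) ?nnegrE ?mulr_ge0 ?powR_ge0 ?ler0n //.
rewrite exprMn -[(_ `^ _) ^+ 3]powR_mulrn ?powR_ge0 // -powRrM.
have -> : 4 / 3 * 3%:R = 4%:R :> R by field.
rewrite powR_mulrn ?ler0n // -!natrX -natrM ler_nat.
exact: h.
Qed.

Theorem theorem1 (R : realType) (d : nat) (d_gt0 : (0 < d)%N) :
  (exists2 m : nat, is_fae R d m & m%:R <= 5 * d%:R `^ (13 / 9) :> R) /\
  (forall A : {fset 'rV[R]_d}, almost_equidistant A ->
     #|` A|%:R <= 5 * d%:R `^ (13 / 9) :> R).
Proof.
have bound (A : {fset 'rV[R]_d}) : almost_equidistant A ->
    #|` A|%:R <= 5 * d%:R `^ (13 / 9) :> R.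
  move=> aeA; apply: le_thirteen_ninths_power => //.
  exact: almost_equidistant_card.
split=> //.
pose attained m := `[< exists2 A : {fset 'rV[R]_d}, almost_equidistant A
                                                   & #|` A| = m >].
have attained0 : exists m, attained m.
  exists 0%N; apply/asboolP; exists fset0; last exact: cardfs0.
  by move=> x y z; rewrite inE.
have attained_le m : attained m -> (m <= 125 * d ^ 4)%N.
  move=> /asboolP[A aeA <-].
  apply: leq_trans (almost_equidistant_card d_gt0 aeA).
  by case: #|` A| => // k; rewrite -[leqLHS]expn1 leq_pexp2l.
case: (ex_maxnP attained0 attained_le) => m /asboolP[A aeA Am] mmax.
exists m; last by rewrite -Am; exact: bound.
split; first by exists A.
by move=> B aeB; apply: mmax; apply/asboolP; exists B.
Qed.
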